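(* Let $\beta>0$, let $A,B:\mathcal X\rightrightarrows\mathcal X$ be maximal $\beta$-strongly monotone with $(A+B)^{-1}(0)\neq\emptyset$, let $\gamma>0$ and $\theta_0:=1+\gamma\beta/2$. Then the sequence $\{z_k=(u_k,v_k,x_k)\}_{k\ge1}$ generated by the relaxed Peaceman–Rachford splitting method with relaxation parameter $\theta=2\theta_0$ from any $x_0\in\mathcal X$ converges to some point lying in $(\mathcal L_{\theta_0}+\gamma C)^{-1}(0)$.
   Context: $\mathcal X$ is a finite-dimensional real vector space with inner product $\langle\cdot,\cdot\rangle_{\mathcal X}$ and associated norm $\|\cdot\|_{\mathcal X}$. For $\beta\ge 0$, a set-valued operator $T:\mathcal X\rightrightarrows\mathcal X$ is $\beta$-strongly monotone if $\langle w-w',x-x'\rangle_{\mathcal X}\ge\beta\|x-x'\|_{\mathcal X}^2$ whenever $w\in T(x)$, $w'\in T(x')$; it is maximal $\beta$-strongly monotone if it is maximal monotone and $\beta$-strongly monotone. $J_T:=(I+T)^{-1}$ is the resolvent. Relaxed Peaceman–Rachford splitting method with parameters $\theta>0$, $\gamma>0$: given $x_0\in\mathcal X$, for $k\ge1$, $$u_k:=J_{\gamma A}(x_{k-1}),\quad v_k:=J_{\gamma B}(2u_k-x_{k-1}),\quad x_k:=x_{k-1}+\theta(v_k-u_k).$$ For $\tilde\theta>0$, $\mathcal L_{\tilde\theta}:\mathcal X^3\to\mathcal X^3$ is the linear map $$\mathcal L_{\tilde\theta}(u,v,x)=\big((1-\tilde\theta)u+\tilde\theta v-x,\ (\tilde\theta-2)u+(1-\tilde\theta)v+x,\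 u-v\big),$$ and $C:\mathcal X^3\rightrightarrows\mathcal X^3$ is $C(u,v,x)=A(u)\times B(v)\times\{0\}$. $(\mathcal L_{\tilde\theta}+\gamma C)^{-1}(0)$ is the set of $z$ with $0\in\mathcal L_{\tilde\theta}(z)+\gamma C(z)$. *)

(* Defs.v *)
From mathcomp Require Import all_boot all_order all_algebra sesquilinear.
From mathcomp Require Import all_classical all_reals all_analysis.

Set Implicit Arguments.
Unset Strict Implicit.
Unset Printing Implicit Defensive.

Import Order.TTheory GRing.Theory Num.Theory.
Import numFieldNormedType.Exports.
Local Open Scope classical_set_scope.
Local Open Scope ring_scope.

(* Set-valued operators on a real vector space V are functions V -> set V. *)
Section Operators.
Context {R : realType} {V : lmodType R}.
Implicit Types S T : V -> set V.

Definition op_fun (f : V -> V) : V -> set V := fun x => [set f x].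

Definition op_add S T : V -> set V := fun x => [set s + t | s in S x & t in T x].

Definition op_scale (c : R) T : V -> set V := fun x => [set c *: w | w in T x].

Definition op_inv T : V -> set V := fun w => [set x | T x w].

End Operators.

Section Monotone.
Context {R : realType} {X : vectType R} (ip : {dot X for idfun}).
Implicit Types T : X -> set X.

Definition ipnorm (x : X) : R := Num.sqrt (ip x x).

Definition monotone T : Prop :=
  forall x x' w w', T x w -> T x' w' -> 0 <= ip (w - w') (x - x').

Definition maximal_monotone T : Prop :=
  monotone T /\
  forall T', monotone T' -> (forall x, T x `<=` T' x) -> forall x, T' x `<=` T x.

Definition strongly_monotone (beta : R) T : Prop :=
  forall x x' w w', T x w -> T x' w' ->
    beta * ipnorm (x - x') ^+ 2 <= ip (w - w') (x - x').

Definition maximal_strongly_monotone (beta : R) T : Prop :=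
  maximal_monotone T /\ strongly_monotone beta T.

End Monotone.

(* The value of (I + T)^-1 at x. For maximal monotone T the set
   op_inv (op_add (op_fun id) T) x is a singleton (Minty), and resolvent T x
   is its element; the default 0 is only returned when that set is empty. *)
Definition resolvent {R : realType} {X : vectType R} (T : X -> set X) (x : X) : X :=
  xget 0 (op_inv (op_add (op_fun id) T) x).

Definition relaxed_PR {R : realType} {X : vectType R} (A B : X -> set X)
    (gamma theta : R) (x0 : X) (u v x : nat -> X) : Prop :=
  x 0%N = x0 /\
  forall k, (1 <= k)%N ->
    [/\ u k = resolvent (op_scale gamma A) (x k.-1),
        v k = resolvent (op_scale gamma B) (2 *: u k - x k.-1) &
        x k = x k.-1 + theta *: (v k - u k)].

Section Product.
Context {R : realType} {X : vectType R}.

(* A triple (u, v, x) is ((u, v), x) : X * X * X. *)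
Definition opL (theta : R) (z : X * X * X) : X * X * X :=
  let: (u, v, x) := z in
  ((1 - theta) *: u + theta *: v - x,
   (theta - 2) *: u + (1 - theta) *: v + x,
   u - v).

Definition opC (A B : X -> set X) (z : X * X * X) : set (X * X * X) :=
  let: (u, v, x) := z in A u `*` B v `*` [set 0].

Variable ip : {dot X for idfun}.

Definition ipnorm3 (z : X * X * X) : R :=
  let: (u, v, x) := z in Num.sqrt (ip u u + ip v v + ip x x).

Definition converges3 (z : nat -> X * X * X) (l : X * X * X) : Prop :=
  ipnorm3 (z k - l) @[k --> \oo] --> (0 : R).

End Product.

(* Main.v *)
(* Put s = gamma * beta, replace A, B by gamma A, gamma B, and let (us, xs)
   satisfy xs - us in A us and us - xs in B us. With a = u - us, b = v - us,
   xi = x - xs and theta = 2 + s, strong monotonicity says that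
   P = <xi - a, a> - s |a|^2 and Q = <2 a - xi - b, b> - s |b|^2 are
   nonnegative, and one step of the method satisfies
     |xi_next|^2 = |xi|^2 - theta s |a + b|^2 - 2 theta (P + Q).
   So |xi| decreases and P, Q and a + b tend to 0. When a + b = 0 the
   difference P - Q equals 2 |a|^2, whence a and b tend to 0 as well. Finally,
   for any cluster point xl of x the pair (us, xl) is again a fixed pair,
   because maximal monotone graphs are closed; |x - xl| then decreases and has 0 as a
   cluster value, so x converges to xl. *)

Require Import Defs.
From mathcomp Require Import all_boot all_order all_algebra sesquilinear.
From mathcomp Require Import all_classical all_reals all_analysis.
From mathcomp Require Import ring lra.

Set Implicit Arguments.
Unset Strict Implicit.

Import Order.TTheory GRing.Theory Num.Theory.
Import numFieldNormedType.Exports.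
Local Open Scope classical_set_scope.
Local Open Scope ring_scope.

(** * Inner-product calculus and limits measured by squared distance *)

Section InnerProduct.
Context {R : realType} {X : vectType R} (ip : {dot X for idfun}).
Implicit Types (x y z : X) (c : R).

Lemma ipC x y : ip x y = ip y x.
Proof. by rewrite (hermC (theta := idfun)) /= mul1r. Qed.

Lemma ipDl x y z : ip (x + y) z = ip x z + ip y z.
Proof. exact: linearDl. Qed.

Lemma ipDr x y z : ip z (x + y) = ip z x + ip z y.
Proof. by rewrite ipC ipDl !(ipC _ z). Qed.

Lemma ipNl x y : ip (- x) y = - ip x y.
Proof. exact: linearNl. Qed.

Lemma ipNr x y : ip y (- x) = - ip y x.
Proof. by rewrite ipC ipNl (ipC _ y). Qed.

Lemma ipZl c x y : ip (c *: x) y = c * ip x y.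
Proof. exact: linearZl_LR. Qed.

Lemma ipZr c x y : ip y (c *: x) = c * ip y x.
Proof. by rewrite ipC ipZl (ipC _ y). Qed.

Definition ipE := (ipDl, ipDr, ipNl, ipNr, ipZl, ipZr).

Lemma ip0l x : ip 0 x = 0.
Proof. by rewrite -(scale0r x) ipZl mul0r. Qed.

Lemma ip_gt0 x : x != 0 -> 0 < ip x x.
Proof. exact: neq0_dnorm_gt0. Qed.

Lemma ip_ge0 x : 0 <= ip x x.
Proof. by have [->|/ip_gt0/ltW//] := eqVneq x 0; rewrite ip0l. Qed.

Lemma ip_CauchySchwarz x y : ip x y ^+ 2 <= ip x x * ip y y.
Proof.
have [->|/ip_gt0 y0] := eqVneq y 0.
  by rewrite ipC !ip0l expr0n mulr0.
(* This vector is |y|^2 times the component of x orthogonal to y. *)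
have := ip_ge0 (ip y y *: x - ip x y *: y).
rewrite !ipE (ipC y x) => h.
have : 0 <= ip y y * (ip x x * ip y y - ip x y ^+ 2).
  by apply: le_trans h _; rewrite le_eqVlt; apply/orP; left; apply/eqP; ring.
by rewrite pmulr_rge0// subr_ge0.
Qed.

Lemma sqr_ipnorm x : ipnorm ip x ^+ 2 = ip x x.
Proof. by rewrite sqr_sqrtr// ip_ge0. Qed.

Lemma ip_subC x y : ip (x - y) (x - y) = ip (y - x) (y - x).
Proof. by rewrite -opprB ipNl ipNr opprK. Qed.

Section Convergence.
Context {T : Type} (F : set_system T) {FF : Filter F}.
Implicit Types f g : T -> X.

Lemma cvg_ge0_squeeze (p q : T -> R) :
  (forall t, 0 <= p t <= q t) -> q @ F --> (0 : R) -> p @ F --> (0 : R).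
Proof.
move=> pq; apply: squeeze_cvgr; last exact: cvg_cst.
by apply: nearW.
Qed.

(** Vector limits are encoded as limits of real squared distances: X carries only its algebraic
    structure, and the square keeps estimates polynomial. *)
Definition ipcvg f x := ip (f t - x) (f t - x) @[t --> F] --> (0 : R).

Lemma ipcvg_cst x : ipcvg (fun=> x) x.
Proof. by rewrite /ipcvg subrr ip0l; exact: cvg_cst. Qed.

Lemma ipcvgZD c f g x y : ipcvg f x -> ipcvg g y ->
  ipcvg (fun t => c *: f t + g t) (c *: x + y).
Proof.
move=> fx gy.
apply: (@cvg_ge0_squeeze _ (fun t => 2 * c ^+ 2 * ip (f t - x) (f t - x)
   + 2 * ip (g t - y) (g t - y))) => [t|].
  rewrite ip_ge0 /=.
  have -> : c *: f t + g t - (c *: x + y) = c *: (f t - x) + (g t - y).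
    by rewrite scalerBr opprD addrACA.
  move: (f t - x) (g t - y) => a b.
  have := ip_ge0 (c *: a - b); rewrite !ipE (ipC b a); nra.
rewrite [X in _ --> X](_ : 0 = 2 * c ^+ 2 * 0 + 2 * 0); last by ring.
by apply: cvgD; apply: cvgM => //; exact: cvg_cst.
Qed.

Lemma ipcvgZ c f x : ipcvg f x -> ipcvg (fun t => c *: f t) (c *: x).
Proof.
move=> /(ipcvgZD c) /(_ (ipcvg_cst 0)); rewrite addr0.
by under [X in ipcvg X]eq_fun do rewrite addr0.
Qed.

Lemma ipcvgD f g x y : ipcvg f x -> ipcvg g y ->
  ipcvg (fun t => f t + g t) (x + y).
Proof.
move=> fx /(ipcvgZD 1 fx); rewrite scale1r.
by under [X in ipcvg X]eq_fun do rewrite scale1r.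
Qed.

Lemma ipcvgB f g x y : ipcvg f x -> ipcvg g y ->
  ipcvg (fun t => f t - g t) (x - y).
Proof.
move=> fx /(ipcvgZ (-1)) /(ipcvgD fx); rewrite scaleN1r.
by under [X in ipcvg X]eq_fun do rewrite scaleN1r.
Qed.

Lemma cvg_ip_bounded0 f g M : (forall t, ip (g t) (g t) <= M) ->
  ip (f t) (f t) @[t --> F] --> (0 : R) ->
  ip (f t) (g t) @[t --> F] --> (0 : R).
Proof.
move=> gM f0; apply/norm_cvg0P.
apply: (@cvg_ge0_squeeze _ (fun t => Num.sqrt (M * ip (f t) (f t)))) => [t|].
  rewrite normr_ge0 /= -sqrtr_sqr ler_wsqrtr//.
  by rewrite (le_trans (ip_CauchySchwarz _ _))// mulrC ler_wpM2r ?ip_ge0.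
rewrite [X in _ --> X](_ : 0 = Num.sqrt (M * 0)); last by rewrite mulr0 sqrtr0.
apply: continuous_cvg; first exact: sqrt_continuous.
by apply: cvgM => //; exact: cvg_cst.
Qed.

Lemma cvg_ip f g x y : ipcvg f x -> ipcvg g y ->
  ip (f t) (g t) @[t --> F] --> ip x y.
Proof.
move=> fx gy.
have -> : (fun t => ip (f t) (g t)) =
    (fun t => (ip (f t - x) (g t - y) + ip (f t - x) y + ip (g t - y) x)
      + ip x y).
  by apply/funext => t; rewrite !ipE (ipC (g t) x) (ipC y x); ring.
rewrite -[X in _ --> X]add0r; apply: cvgD; last exact: cvg_cst.
rewrite [X in _ --> X](_ : 0 = (0 + 0) + 0 :> R); last by rewrite !addr0.
apply: cvgD; [apply: cvgD|].
- apply/norm_cvg0P; apply: (@cvg_ge0_squeeze _ (fun t =>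
     ip (f t - x) (f t - x) + ip (g t - y) (g t - y))) => [t|].
    rewrite normr_ge0 /= ler_norml.
    move: (f t - x) (g t - y) => a b.
    have := ip_ge0 (a - b); have := ip_ge0 (a + b).
    by rewrite !ipE (ipC b a); have := ip_ge0 a; have := ip_ge0 b; lra.
  rewrite [X in _ --> X](_ : 0 = 0 + 0 :> R); last by rewrite addr0.
  exact: cvgD.
- exact: (@cvg_ip_bounded0 _ (fun=> y) (ip y y)).
- exact: (@cvg_ip_bounded0 _ (fun=> x) (ip x x)).
Qed.

End Convergence.

Lemma ipcvg_filter {T : Type} (F G : set_system T) (f : T -> X) x :
  F `<=` G -> ipcvg F f x -> ipcvg G f x.
Proof. by move=> FG + A /[dup] nA => /[apply] /FG. Qed.

End InnerProduct.

(** * Compactness of bounded sets, along ultrafilters *)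

Lemma ultra_bounded_cvg {R : realType} {T : Type} (G : set_system T)
    (GU : UltraFilter G) (g : T -> R) (M : R) :
  (forall t, `|g t| <= M) -> exists c : R, g t @[t --> G] --> c.
Proof.
move=> gM.
have GP : ProperFilter (g @ G) by apply: fmap_proper_filter.
have [|c [_ gc]] := @segment_compact R (- M) M (g @ G) _.
  by apply: nearW => t /=; rewrite in_itv /= -ler_norml.
exists c => A cA.
(* A cluster point of an ultrafilter is its limit: otherwise the complement of some neighbourhood
   would be large, yet it cannot meet that neighbourhood. *)
have [//|GA] := in_ultra_setVsetC (g @^-1` A) GU.
by have [x []] := gc (~` A) A GA cA.
Qed.

Section FiniteDimension.
Context {R : realType} {X : vectType R} (ip : {dot X for idfun}).

(* Induction on the dimension of a subspace containing the values of [f]: split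
   off the component along one vector and recurse in its orthogonal. *)
Lemma ultra_bounded_ipcvg {T : Type} (G : set_system T)
    (GU : UltraFilter G) (f : T -> X) (M : R) :
  (forall t, ip (f t) (f t) <= M) -> exists x, ipcvg ip G f x.
Proof.
suff H n : forall (U : {vspace X}) g,
    (\dim U <= n)%N -> (forall t, g t \in U) ->
    (forall t, ip (g t) (g t) <= M) -> exists x, ipcvg ip G g x.
  by move=> fM; apply: (H _ fullv f (leqnn _) _ fM) => t; rewrite memvf.
elim: n => [|n IH] U g dimU gU gM.
  exists 0; rewrite (_ : g = (fun=> 0)); first by apply: ipcvg_cst.
  apply/funext => t; apply/eqP; rewrite -memv0.
  by have := gU t; move: dimU; rewrite leqn0 dimv_eq0 => /eqP ->.
have [U0|U0] := eqVneq U 0%VS; first by apply: (IH U) => //; rewrite U0 dimv0.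
pose e := vpick U.
have eU : e \in U by exact: memv_pick.
have e0 : 0 < ip e e by apply: ip_gt0; rewrite vpick0.
pose c t := ip (g t) e / ip e e.
pose h t := g t - c t *: e.
have he t : ip (h t) e = 0.
  by rewrite /h !ipE /c divfK ?subrr ?gt_eqF.
have gE t : ip (g t) (g t) = c t ^+ 2 * ip e e + ip (h t) (h t).
  have -> : g t = c t *: e + h t by rewrite /h addrC subrK.
  move: (he t); move: (h t) (c t) => ht ct het.
  by rewrite !ipE (ipC ip e) het; ring.
have [|k ck] := @ultra_bounded_cvg R T G GU c (Num.sqrt (M / ip e e)).
  move=> t; rewrite -sqrtr_sqr ler_wsqrtr// ler_pdivlMr//.
  by rewrite (le_trans _ (gM t))// gE lerDl ip_ge0.
have [|||y hy] := IH (U :&: orthov ip <[e]>)%VS h.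
(* The dimension drops: otherwise e, which lies in U, would be orthogonal to itself. *)
- rewrite -ltnS (leq_trans _ dimU)// ltn_neqAle dimvS ?capvSl// andbT.
  apply: contraTneq e0 => dimE.
  have /eqP UE : (U :&: orthov ip <[e]>)%VS == U.
    by rewrite eqEdim capvSl dimE /=.
  move: eU; rewrite -UE memv_cap => /andP[_]; rewrite mem_orthov1 => /eqP ->.
  by rewrite ltxx.
- move=> t; rewrite memv_cap mem_orthov1; apply/andP; split; last exact/eqP/he.
  by rewrite rpredB ?gU// rpredZ.
- by move=> t; rewrite (le_trans _ (gM t))// gE lerDr mulr_ge0 ?sqr_ge0 ?ltW.
exists (k *: e + y).
rewrite (_ : g = fun t => c t *: e + h t); last first.
  by apply/funext => t; rewrite /h addrC subrK.
apply: ipcvgD hy.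
have : (c t - k) * (c t - k) * ip e e @[t --> G] --> (k - k) * (k - k) * ip e e.
  by apply: cvgM; [apply: cvgM; apply: cvgB => //|]; exact: cvg_cst.
rewrite subrr !mul0r /ipcvg.
rewrite (_ : (fun t => ip (c t *: e - k *: e) (c t *: e - k *: e)) =
  (fun t => (c t - k) * (c t - k) * ip e e))//.
by apply/funext => t; rewrite -scalerBl ipZl ipZr mulrA.
Qed.

End FiniteDimension.

(** * Maximal monotone operators and Minty's theorem *)

Section MaximalMonotone.
Context {R : realType} {X : vectType R} (ip : {dot X for idfun}).
Implicit Types (x w : X) (T : X -> set X).

(** Makes maximality a pointwise test: adjoining one point monotonically related to the graph
    already gives a monotone extension. *)
Lemma maximal_monotoneP T : maximal_monotone ip T <->
  Defs.monotone ip T /\ forall x w,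
    (forall x' w', T x' w' -> 0 <= ip (w - w') (x - x')) -> T x w.
Proof.
split=> -[Tmon Tmax]; split=> //.
  move=> x w xw.
  apply: (Tmax (fun x' w' => T x' w' \/ x' = x /\ w' = w)); [|by left|by right].
  move=> y y' v v' [Tv|[-> ->]] [Tv'|[-> ->]].
  - exact: Tmon.
  - by rewrite -(opprB w) -(opprB x) ipNl ipNr opprK; exact: xw.
  - exact: xw.
  - by rewrite !subrr ip0l.
move=> T' T'mon TT' x w T'w; apply: Tmax => x' w' /TT' T'w'.
exact: T'mon.
Qed.

Lemma maximal_monotone_scale T c : 0 < c ->
  maximal_monotone ip T -> maximal_monotone ip (op_scale c T).
Proof.
move=> c0 /maximal_monotoneP[Tmon Tmax]; apply/maximal_monotoneP; split.
  move=> x x' _ _ [w Tw <-] [w' Tw' <-].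
  by rewrite -scalerBr ipZl mulr_ge0 ?Tmon ?ltW.
move=> x w xw; exists (c^-1 *: w); last by rewrite scalerA divff ?scale1r ?gt_eqF.
apply: Tmax => x' w' Tw'.
rewrite -(pmulr_rge0 _ c0) -ipZl scalerBr scalerA divff ?gt_eqF// scale1r.
by apply: xw; exists w'.
Qed.

Lemma maximal_monotone_closed T (I : Type) (F : set_system I)
    {FF : ProperFilter F} (f g : I -> X) x w :
  maximal_monotone ip T -> (forall i, T (f i) (g i)) ->
  ipcvg ip F f x -> ipcvg ip F g w -> T x w.
Proof.
move=> /maximal_monotoneP[Tmon Tmax] Tfg fx gw; apply: Tmax => x' w' Tw'.
have : ip (g i - w') (f i - x') @[i --> F] --> ip (w - w') (x - x').
  by apply: cvg_ip; apply: ipcvgB => //; exact: ipcvg_cst.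
by move=> /cvgr_to_ge; apply; apply: nearW => i; exact: Tmon.
Qed.

(* [c] is at least the Fitzpatrick function of [T] at [(x, w)]. *)
Definition fitzpatrick_epi T x w (c : R) :=
  forall x' w', T x' w' -> ip w' x + ip w x' - ip w' x' <= c.

(** If c < <w, x>, the epigraph inequalities put (x, w) in the graph by maximality; testing them at
    (x, w) itself then gives <w, x> <= c. *)
Lemma fitzpatrick_ge T x w c :
  maximal_monotone ip T -> fitzpatrick_epi T x w c -> ip w x <= c.
Proof.
move=> /maximal_monotoneP[Tmon Tmax] xwc; rewrite leNgt; apply/negP => cwx.
have Tw : T x w.
  apply: Tmax => x' w' /xwc.
  by rewrite !ipE; lra.
by have := xwc _ _ Tw; lra.
Qed.

(* Minimise |x - w|^2 / 4 + c over the (convex) Fitzpatrick epigraph, where it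
   is nonnegative. Along a minimising sequence y = (x - w) / 2 is bounded, and
   first-order optimality in the direction of a graph point (x', w') reads
   0 <= <w' + y, x' - y> up to an error that vanishes; a cluster point of y
   therefore solves the problem by maximality. *)
Lemma Minty_at0 T : maximal_monotone ip T -> exists x, T x (- x).
Proof.
move=> Tmax; have [Tmon Tchar] := (maximal_monotoneP T).1 Tmax.
pose E := [set r | exists p : X * X * R, fitzpatrick_epi T p.1.1 p.1.2 p.2 /\
  r = ip (p.1.1 - p.1.2) (p.1.1 - p.1.2) / 4 + p.2].
have Tepi x w : T x w -> fitzpatrick_epi T x w (ip w x).
  move=> Tw x' w' Tw'; have := Tmon _ _ _ _ Tw Tw'.
  by rewrite !ipE; lra.
(* With an empty graph, (0, 0) would pass the maximality test vacuously. *)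
have [x1 [w1 Tw1]] : exists x w, T x w.
  apply: contrapT => T0; apply: (T0); exists 0, 0; apply: Tchar => x' w' Tw'.
  by case: T0; exists x', w'.
have E_ge0 r : E r -> 0 <= r.
  move=> [[[x w] c] /= [/(fitzpatrick_ge Tmax) cwx ->]].
  by have := ip_ge0 ip (x + w); rewrite !ipE (ipC ip w x) in cwx *; lra.
have Einf : has_inf E.
  split; last by exists 0; exact: E_ge0.
  by exists (ip (x1 - w1) (x1 - w1) / 4 + ip w1 x1); exists (x1, w1, ip w1 x1);
     split => //=; exact: Tepi.
(* The minimising error is d^2 and the test step has length d, so dividing by d leaves an error of
   order d. *)
pose d n : R := harmonic n / 4.
have d_gt0 n : 0 < d n by rewrite /d divr_gt0 ?harmonic_gt0.
have d_le n : d n <= 4^-1.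
  rewrite /d ler_piMl// /harmonic invf_le1//; first by rewrite ler1n.
have inf_ge0 : 0 <= inf E by apply: lb_le_inf; [case: Einf|].
have /choice[p pE] : forall n, exists p : X * X * R,
    fitzpatrick_epi T p.1.1 p.1.2 p.2 /\
    ip (p.1.1 - p.1.2) (p.1.1 - p.1.2) / 4 + p.2 < inf E + d n ^+ 2.
  move=> n; have [|_ [p [pE ->]] lt] := @inf_adherent R E (d n ^+ 2) _ Einf.
    by rewrite exprn_gt0.
  by exists p.
pose y n := 2^-1 *: ((p n).1.1 - (p n).1.2).
have key n x w : T x w -> 0 <=
    d n * (1 + ip (2^-1 *: (x - w) - y n) (2^-1 *: (x - w) - y n)) +
    ip (w + y n) (x - y n).
  move=> Tw; move: (pE n) (d_gt0 n) (d_le n); rewrite /y.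
  case: (p n) (d n) => [[a b] c] t /= [abc lt] t0 t1.
  set v := 2^-1 *: (a - b); set D := 2^-1 *: (x - w) - v.
  have abE : a - b = 2 *: v by rewrite /v scalerA divff ?scale1r.
  have DE : 2 *: D = (x - w) - (a - b).
    by rewrite scalerBr scalerA divff// scale1r -abE.
  clearbody v D.
  (* With [inf_ge0] this gives |v|^2 + c >= 0, which is the gap between <w + v, x - v> and the
     first-order term 2 <v, D> + <w, x> - c. *)
  have inf_v : inf E <= ip v v + c.
    apply: ge_inf; first by case: Einf.
    by exists (a, b, c); split => //=; rewrite abE !ipE; lra.
  (* Move by t from the near-minimiser towards (x, w, <w, x>); convexity of the epigraph keeps the
     point admissible, and v moves to v + t D. *)
  have : inf E <= ip (v + t *: D) (v + t *: D) + (c + t * (ip w x - c)).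
    apply: ge_inf; first by case: Einf.
    exists (a + t *: (x - a), b + t *: (w - b), c + t * (ip w x - c)).
    split=> /= [x' w' Tw'|].
      have := abc _ _ Tw'; have := Tepi _ _ Tw _ _ Tw'.
      by rewrite !ipE; nra.
    have -> : a + t *: (x - a) - (b + t *: (w - b)) = 2 *: (v + t *: D).
      rewrite [RHS]scalerDr scalerA (mulrC 2) -scalerA DE -abE.
      rewrite opprD addrACA -scalerBr; congr (_ + _ *: _).
      by rewrite !opprB addrACA [RHS]addrACA (addrC (- w)).
    by rewrite [in RHS]ipZl [in RHS]ipZr; lra.
  move: lt; rewrite abE => lt le.
  rewrite -(pmulr_rge0 _ t0).
  have : 2 * ip v D = ip v x - ip v w - 2 * ip v v.
    by rewrite -ipZr DE abE !ipE.
  move: lt le; rewrite !ipE (ipC ip D v) (ipC ip w v).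
  move: (ip D D) (ip v D) => DD vD.
  nra.
have [G [GU leG]] := ultraFilterLemma eventually_filter.
have [|l yl] := @ultra_bounded_ipcvg R X ip _ G GU y
    (1 + 2 * ip (2^-1 *: (x1 - w1)) (2^-1 *: (x1 - w1)) + 4 * ip w1 x1 +
     4 * ip (x1 - w1) (x1 - w1)).
  (* Since t <= 1/4, the bounds |a - v|^2 <= 2 |a|^2 + 2 |v|^2 and <v, b> <= |v|^2 / 4 + |b|^2
     absorb three quarters of |v|^2. *)
  move=> n; have := key n _ _ Tw1; move: (d_gt0 n) (d_le n) (y n) => t0 t1 v.
  set a := 2^-1 *: (x1 - w1); set b := x1 - w1.
  have : ip v x1 - ip v w1 = ip v b by rewrite /b !ipE.
  have := ip_ge0 ip (a + v); have := ip_ge0 ip (v - 2 *: b).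
  have := ip_ge0 ip (a - v); clearbody a b.
  rewrite !ipE (ipC ip a v) (ipC ip b v) (ipC ip w1 v).
  by move=> h0 h1 h2 h3 h4; nra.
exists l; apply: Tchar => x w Tw.
have -> : ip (- l - w) (l - x) = ip (w + l) (x - l).
  by rewrite -(opprB x) -opprD ipNl ipNr opprK addrC.
pose q n := ip (2^-1 *: (x - w) - y n) (2^-1 *: (x - w) - y n).
have qG : q n @[n --> G] --> ip (2^-1 *: (x - w) - l) (2^-1 *: (x - w) - l).
  by apply: cvg_ip; apply: ipcvgB => //; exact: ipcvg_cst.
have dG : d n @[n --> G] --> (0 : R).
  rewrite -[X in _ --> X](mul0r 4^-1); apply: cvgM; last exact: cvg_cst.
  by apply: cvg_trans cvg_harmonic => A; exact: leG.
have : d n * (1 + q n) + ip (w + y n) (x - y n) @[n --> G] -->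
    0 * (1 + ip (2^-1 *: (x - w) - l) (2^-1 *: (x - w) - l)) + ip (w + l) (x - l).
  apply: cvgD; first by apply: cvgM => //; apply: cvgD => //; exact: cvg_cst.
  by apply: cvg_ip; [apply: ipcvgD|apply: ipcvgB] => //; exact: ipcvg_cst.
rewrite mul0r add0r => /cvgr_to_ge; apply; apply: nearW => n; exact: key.
Qed.

(** Translating the values of T by y preserves maximal monotonicity and reduces to [Minty_at0]. *)
Lemma Minty T y : maximal_monotone ip T -> exists x, T x (y - x).
Proof.
move=> /maximal_monotoneP[Tmon Tchar].
have [|x Tx] := @Minty_at0 (fun x w => T x (w + y));
  last by exists x; rewrite addrC.
apply/maximal_monotoneP; split=> [x x' w w' Tw Tw'|x w xw].
  by have := Tmon _ _ _ _ Tw Tw'; rewrite opprD addrACA subrr addr0.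
apply: Tchar => x' w' Tw'; have := xw x' (w' - y).
by rewrite opprB addrA; apply; rewrite subrK.
Qed.

(** By [Minty] the set defining the resolvent is nonempty, so [xget] does not fall back on its
    default. *)
Lemma resolvent_spec T x : maximal_monotone ip T ->
  T (resolvent T x) (x - resolvent T x).
Proof.
move=> /(Minty x)[u Tu].
have [_ -> [t Tt xE]] : op_inv (op_add (op_fun id) T) x (resolvent T x).
  apply: xgetPex; exists u; exists u => //.
  by exists (x - u) => //; rewrite addrC subrK.
by rewrite -[X in X - _]xE addrAC subrr add0r.
Qed.

End MaximalMonotone.

(** * The relaxed Peaceman-Rachford iteration *)

Section PeacemanRachford.
Context {R : realType} {X : vectType R} (ip : {dot X for idfun}).

Lemma strongly_monotone_scale (T : X -> set X) beta c : 0 < c ->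
  strongly_monotone ip beta T -> strongly_monotone ip (c * beta) (op_scale c T).
Proof.
move=> c0 Tmon x x' _ _ [w Tw <-] [w' Tw' <-].
by rewrite -scalerBr ipZl -mulrA ler_wpM2l ?Tmon ?ltW.
Qed.

(** For a general parameter theta the remainder is theta times (theta - 2 - 2 s) (|a|^2 + |b|^2) + 2
    (2 - theta) <a, b>. The two coefficients agree exactly at theta = 2 + s, leaving a multiple of
    |a + b|^2. *)
Lemma PR_energy (s : R) (a b xi : X) :
  ip (xi + (2 + s) *: (b - a)) (xi + (2 + s) *: (b - a)) =
  ip xi xi - ((2 + s) * s * ip (a + b) (a + b) +
    2 * (2 + s) * ((ip (xi - a) a - s * ip a a) +
                   (ip (2 *: a - xi - b) b - s * ip b b))).
Proof. by rewrite !ipE (ipC ip b a) (ipC ip a xi) (ipC ip b xi); ring. Qed.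

(* The right-hand side tends to 0 along the iteration by [PR_energy]. *)
Lemma PR_gap (s : R) (a b xi : X) :
  ip (a - b) (a - b) = ip (a + b) (a + b) +
    2 * ((ip (xi - a) a - s * ip a a) - (ip (2 *: a - xi - b) b - s * ip b b)
      - ip (a + b) xi + (1 + s) * ip (a + b) (a - b)).
Proof. by rewrite !ipE (ipC ip b a) (ipC ip a xi) (ipC ip b xi); ring. Qed.

Section Iteration.
(** A and B stand for the operators already scaled by gamma. The indices of u and v are shifted so
    that [u k] and [v k] are computed from [x k]. *)
Variables (A B : X -> set X) (s : R) (u v x : nat -> X).
Hypotheses (s_gt0 : 0 < s).
Hypotheses (Amax : maximal_monotone ip A) (Bmax : maximal_monotone ip B).
Hypotheses (Astr : strongly_monotone ip s A) (Bstr : strongly_monotone ip s B).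
Hypotheses (Au : forall k, A (u k) (x k - u k))
  (Bv : forall k, B (v k) (2 *: u k - x k - v k))
  (xS : forall k, x k.+1 = x k + (2 + s) *: (v k - u k)).

Section Fixed.
Variables (us xs : X).
Hypotheses (Aus : A us (xs - us)) (Bus : B us (us - xs)).

Let a k := u k - us.
Let b k := v k - us.
Let xi k := x k - xs.
Let d k := ip (xi k) (xi k).
Let P k := ip (xi k - a k) (a k) - s * ip (a k) (a k).
Let Q k := ip (2 *: a k - xi k - b k) (b k) - s * ip (b k) (b k).

Let P_ge0 k : 0 <= P k.
Proof.
have := Astr (Au k) Aus; rewrite sqr_ipnorm /P /xi /a.
by rewrite !(ipDl, ipNl); lra.
Qed.

Let Q_ge0 k : 0 <= Q k.
Proof.
have := Bstr (Bv k) Bus; rewrite sqr_ipnorm /Q /xi /a /b.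
by rewrite !(ipDl, ipNl, ipZl); lra.
Qed.

Let dS k : d k.+1 =
  d k - ((2 + s) * s * ip (a k + b k) (a k + b k) + 2 * (2 + s) * (P k + Q k)).
Proof.
rewrite -PR_energy /d /xi xS addrAC.
by congr (ip (_ + _ *: _) (_ + _ *: _)); rewrite /a /b opprB addrA subrK.
Qed.

Let sq_ge0 k : 0 <= (2 + s) * s * ip (a k + b k) (a k + b k).
Proof.
by apply: mulr_ge0; [have := s_gt0; nra|exact: ip_ge0].
Qed.

Let PQ_ge0 k : 0 <= 2 * (2 + s) * (P k + Q k).
Proof.
by have := P_ge0 k; have := Q_ge0 k; have := s_gt0; move: (P k) (Q k) => p q; nra.
Qed.

Lemma PR_fejer k : ip (x k.+1 - xs) (x k.+1 - xs) <= ip (x k - xs) (x k - xs).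
Proof.
by have := dS k; have := sq_ge0 k; have := PQ_ge0 k; rewrite /d /xi; lra.
Qed.

Lemma PR_fejer_le m n : (m <= n)%N ->
  ip (x n - xs) (x n - xs) <= ip (x m - xs) (x m - xs).
Proof.
by move/subnK <-; elim: (n - m)%N => [//|i IH]; exact: le_trans (PR_fejer _) IH.
Qed.

Lemma PR_dist_cvg : cvgn (fun k => ip (x k - xs) (x k - xs)).
Proof.
apply: nonincreasing_is_cvgn; last by exists 0 => _ [k _ <-]; exact: ip_ge0.
by move=> m n; exact: PR_fejer_le.
Qed.

Lemma PR_shadow_cvg : ipcvg ip \oo u us /\ ipcvg ip \oo v us.
Proof.
(* The decrements of the convergent sequence d tend to 0 and dominate each nonnegative term of the
   energy identity. *)
pose e k := d k - d k.+1.
have e0 : e k @[k --> \oo] --> (0 : R).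
  have /cvg_ex[l dl] := PR_dist_cvg.
  rewrite -[X in _ --> X](subrr l); apply: cvgB => //.
  by rewrite (cvg_shiftS d).
have eE k : e k =
    (2 + s) * s * ip (a k + b k) (a k + b k) + 2 * (2 + s) * (P k + Q k).
  by rewrite /e dS; ring.
have sum0 : ip (a k + b k) (a k + b k) @[k --> \oo] --> (0 : R).
  apply: (@cvg_ge0_squeeze _ _ _ _ _ (fun k => ((2 + s) * s)^-1 * e k)) => [k|].
    rewrite ip_ge0 /= ler_pdivlMl; last by have := s_gt0; nra.
    by rewrite eE lerDl.
  by rewrite -[X in _ --> X](mulr0 ((2 + s) * s)^-1); apply: cvgM => //;
    exact: cvg_cst.
have PQ0 : P k - Q k @[k --> \oo] --> (0 : R).
  apply/norm_cvg0P; apply: (@cvg_ge0_squeeze _ _ _ _ _ e) => // k.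
  rewrite normr_ge0 /= eE ler_norml.
  have := P_ge0 k; have := Q_ge0 k; have := sq_ge0 k.
  move: (P k) (Q k) (_ * ip _ _) => p q r r0 q0 p0.
  have : 0 <= s * (p + q) by rewrite mulr_ge0 ?addr_ge0// ltW.
  by lra.
have d_le k : d k <= d 0%N by exact: PR_fejer_le.
(* Boundedness of a - b makes <a + b, a - b> vanish in [PR_gap]. The increment of xi is (2 + s)(b -
   a), with squared norm at most 4 d 0, and 2 + s >= 1. *)
have ba_le k : ip (a k - b k) (a k - b k) <= 4 * d 0%N.
  have xE : x k.+1 - xs = xi k + (2 + s) *: (v k - u k) by rewrite xS addrAC.
  have : (2 + s) ^+ 2 * ip (a k - b k) (a k - b k) =
      ip (xi k.+1 - xi k) (xi k.+1 - xi k).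
    have -> : xi k.+1 - xi k = (2 + s) *: (b k - a k).
      by rewrite /xi xE addrC addKr /a /b opprB addrA subrK.
    by rewrite (ip_subC _ (a k)) ipZl ipZr; ring.
  have := d_le k; have := d_le k.+1; have := ip_ge0 ip (xi k.+1 + xi k).
  have := ip_ge0 ip (a k - b k).
  move: (ip (a k - b k) _) s_gt0 => r s0; rewrite /d.
  by move: (xi k) (xi k.+1) => p q; rewrite !ipE; nra.
have diff0 : ip (a k - b k) (a k - b k) @[k --> \oo] --> (0 : R).
  rewrite (_ : (fun k => ip (a k - b k) (a k - b k)) =
      (fun k => ip (a k + b k) (a k + b k) + 2 * (P k - Q k -
        ip (a k + b k) (xi k) + (1 + s) * ip (a k + b k) (a k - b k)))); last first.
    by apply/funext => k; exact: PR_gap.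
  rewrite [X in _ --> X](_ : 0 = 0 + 2 * (0 - 0 + (1 + s) * 0)); last by ring.
  apply: cvgD => //; apply: cvgM; first exact: cvg_cst.
  apply: cvgD; last first.
    by apply: cvgM; [exact: cvg_cst|
      exact: (@cvg_ip_bounded0 _ _ _ _ _ _ _ _ (4 * d 0%N))].
  by apply: cvgB => //; exact: (@cvg_ip_bounded0 _ _ _ _ _ _ _ _ (d 0%N)).
(* By the parallelogram law this is |a|^2 + |b|^2. *)
have half0 : 2^-1 * (ip (a k + b k) (a k + b k) + ip (a k - b k) (a k - b k))
    @[k --> \oo] --> (0 : R).
  rewrite [X in _ --> X](_ : 0 = 2^-1 * (0 + 0)); last by ring.
  by apply: cvgM; [exact: cvg_cst|exact: cvgD].
split; apply: cvg_ge0_squeeze half0 => k; rewrite ip_ge0 /= -/(a k) -/(b k);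
  move: (a k) (b k) => p q; have := ip_ge0 ip p; have := ip_ge0 ip q;
  by rewrite !ipE (ipC ip q p); lra.
Qed.

End Fixed.

Lemma PR_cvg us xs : A us (xs - us) -> B us (us - xs) ->
  exists xl, [/\ A us (xl - us), B us (us - xl),
    ipcvg ip \oo u us, ipcvg ip \oo v us & ipcvg ip \oo x xl].
Proof.
move=> Aus Bus.
have [uc vc] := PR_shadow_cvg Aus Bus.
have [G [GU leG]] := ultraFilterLemma eventually_filter.
have [|z xz] := @ultra_bounded_ipcvg R X ip _ G GU (fun k => x k - xs)
    (ip (x 0%N - xs) (x 0%N - xs)).
  by move=> k; exact: (PR_fejer_le Aus Bus).
have {}xz : ipcvg ip G x (z + xs).
  rewrite (_ : x = fun k => (x k - xs) + xs); last first.
    by apply/funext => k; rewrite subrK.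
  by apply: ipcvgD => //; exact: ipcvg_cst.
have uG := ipcvg_filter leG uc; have vG := ipcvg_filter leG vc.
have Al : A us (z + xs - us).
  by apply: (maximal_monotone_closed Amax Au uG); exact: ipcvgB.
have Bl : B us (us - (z + xs)).
  have -> : us - (z + xs) = 2 *: us - (z + xs) - us.
    by rewrite scaler_nat mulr2n addrAC addrK.
  apply: (maximal_monotone_closed Bmax Bv vG).
  by do 2 apply: ipcvgB => //; exact: ipcvgZ.
exists (z + xs); split=> //.
have /cvg_ex[l xl] := PR_dist_cvg Al Bl.
(* The squared distance to the cluster point converges along [\oo], hence to the same limit along
   the finer G, where that limit is 0. *)
suff l0 : l = 0 by rewrite l0 in xl.
apply: cvg_unique xz => //.
by apply: cvg_trans xl => S; exact: leG.
Qed.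

End Iteration.
End PeacemanRachford.

(** * Return to the triples of the theorem *)

Lemma converges3P {R : realType} {X : vectType R} (ip : {dot X for idfun})
    (u v x : nat -> X) ul vl xl :
  ipcvg ip \oo u ul -> ipcvg ip \oo v vl -> ipcvg ip \oo x xl ->
  converges3 ip (fun k => (u k, v k, x k)) (ul, vl, xl).
Proof.
move=> uc vc xc; rewrite /converges3 [X in _ --> X](_ : 0 = Num.sqrt (0 + 0 + 0)).
  apply: continuous_cvg; first exact: sqrt_continuous.
  by apply: cvgD => //; exact: cvgD.
by rewrite !addr0 sqrtr0.
Qed.

Theorem theorem5p2 (R : realType) (X : vectType R) (ip : {dot X for idfun})
    (beta : R) (A B : X -> set X) (gamma : R) (x0 : X) (u v x : nat -> X) :
  0 < beta ->
  maximal_strongly_monotone ip beta A ->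
  maximal_strongly_monotone ip beta B ->
  op_inv (op_add A B) 0 !=set0 ->
  0 < gamma ->
  let theta0 := 1 + gamma * beta / 2 in
  relaxed_PR A B gamma (2 * theta0) x0 u v x ->
  exists z : X * X * X,
    op_inv (op_add (op_fun (opL theta0)) (op_scale gamma (opC A B))) 0 z /\
    converges3 ip (fun k => (u k, v k, x k)) z.
Proof.
move=> beta0 [Amax Astr] [Bmax Bstr] [us [w Aw [w' Bw' ww']]] gamma0 theta0 [_ PR].
have s0 : 0 < gamma * beta by rewrite mulr_gt0.
have AM := maximal_monotone_scale gamma0 Amax.
have BM := maximal_monotone_scale gamma0 Bmax.
have AS := strongly_monotone_scale gamma0 Astr.
have BS := strongly_monotone_scale gamma0 Bstr.
have thE : 2 * theta0 = 2 + gamma * beta by rewrite /theta0; field.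
have Au k : op_scale gamma A (u k.+1) (x k - u k.+1).
  by have [-> _ _] := PR k.+1 isT; exact: (resolvent_spec _ AM).
have Bv k : op_scale gamma B (v k.+1) (2 *: u k.+1 - x k - v k.+1).
  by have [_ -> _] := PR k.+1 isT; exact: (resolvent_spec _ BM).
have xS k : x k.+1 = x k + (2 + gamma * beta) *: (v k.+1 - u k.+1).
  by have [_ _ ->] := PR k.+1 isT; rewrite thE.
(* As w + w' = 0, the zero us of A + B yields the fixed pair (us, us + gamma w). *)
have Aus : op_scale gamma A us ((us + gamma *: w) - us).
  by exists w => //; rewrite addrAC subrr add0r.
have Bus : op_scale gamma B us (us - (us + gamma *: w)).
  exists w' => //; rewrite opprD addrA subrr add0r -scalerN.
  by congr (_ *: _); apply/eqP; rewrite -addr_eq0 addrC ww'.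
have [xl [[al Al alE] [bl Bl blE] uc vc xc]] :=
  PR_cvg s0 AM BM AS BS Au Bv xS Aus Bus.
exists (us, us, xl); split; last first.
  (* [PR_cvg] gives the limits of [u k.+1] and [v k.+1]; the index shift keeps them. *)
  apply: converges3P xc; rewrite /ipcvg.
    by rewrite -(cvg_shiftS (fun k => ip (u k - us) (u k - us))).
  by rewrite -(cvg_shiftS (fun k => ip (v k - us) (v k - us))).
(* At u = v = us the value of [opL theta0] is (us - xl, xl - us, 0), which gamma al = xl - us and
   gamma bl = us - xl cancel. *)
exists (opL theta0 (us, us, xl)) => //.
exists (gamma *: ((al, bl), 0)); first by exists ((al, bl), 0).
rewrite /opL; congr ((_, _), _) => /=.
- by rewrite alE -scalerDl subrK scale1r addrA subrK subrr.
- rewrite blE -scalerDl (_ : theta0 - 2 + (1 - theta0) = - 1); last by ring.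
  by rewrite scaleN1r addrACA addNr subrr addr0.
- by rewrite scaler0 addr0 subrr.
Qed.
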